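(* Fix a convex subset $E\subset b_o$ containing zero such that $\mathrm{Vol}_{\mathbb R}(E)=1$. For $x\in G$ (with $x\in\overline NP$, the set on which $\alpha_P$ is defined) and $\lambda\in\mathbb C$ we have $$\alpha_P(x)^\lambda=\big|\mathrm{Vol}_{\mathbb R}(P_{b_o}(x(E)))\big|^{\lambda/d}=|\mathrm{Cos}(x\cdot b_o,b_o)|^\lambda .$$ In particular, if $b=k\cdot b_o$ and $c=h\cdot b_o$ are in $\mathcal B$, with $k,h\in K$ (and $h^{-1}k\in\overline NP$), then $$\alpha_P(h^{-1}k)^\lambda=|\mathrm{Cos}(b,c)|^\lambda .$$
   Context: $\mathbb K$ is $\mathbb R$, $\mathbb C$ or the quaternions $\mathbb H$, $d=\dim_{\mathbb R}\mathbb K$, $p,q\ge1$, $p\le q$, $p+q=n+1$. For a square matrix $x$ over $\mathbb K$, $|\det x|=|\det_{\mathbb R}x|^{1/d}$. $G=\mathrm{SL}(n+1,\mathbb K)$, $\theta(x)=(x^* )^{-1}$ with $x^*=\overline x^{\,t}$, $K=\{x\in G: x^*=x^{-1}\}$. $H_o=\mathrm{diag}(\tfrac{q}{n+1}I_p,-\tfrac{p}{n+1}I_q)$, $A=\exp(\mathbb RH_o)$, $M$ is the group of block diagonal matrices $\mathrm{diag}(a,b)\in G$, $a\in\mathrm{GL}(p,\mathbb K)$, $b\in\mathrm{GL}(q,\mathbb K)$, with $|\det a|=|\det b|=1$, $N=\left\{\begin{pmatrix}I_p&X\\ 0&I_q\end{pmatrix}: X\in \mathrm M(p\times q,\mathbb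 K)\right\}$, $\overline N=\theta(N)=\left\{\begin{pmatrix}I_p&0\\ Y&I_q\end{pmatrix}: Y\in \mathrm M(q\times p,\mathbb K)\right\}$, $P=MAN$. $\mathcal B=\mathrm{Gr}_p(\mathbb K)$ is the Grassmann manifold of $p$-dimensional $\mathbb K$-subspaces of $\mathbb K^{n+1}$ (right subspaces when $\mathbb K=\mathbb H$), $e_1,\dots,e_{n+1}$ is the standard basis of $\mathbb K^{n+1}$, and $b_o$ is the span of $e_1,\dots,e_p$; $G$ acts on $\mathcal B$ by its natural action on subspaces, and $\mathcal B=K\cdot b_o=G/P$. Every $x$ in the open dense set $\overline NP\subset G$ is uniquely $x=\bar n\,m\,\alpha_P(x)\,n$ with $\bar n\in\overline N$, $m\in M$, $\alpha_P(x)\in A$, $n\in N$. For $\lambda\in\mathbb C$ and $a=\exp(sH_o)\in A$, $s\in\mathbb R$, $a^\lambda:=\exp\!\big(s\lambda\tfrac{pq}{n+1}\big)$. For $c\in\mathrm{Gr}_p(\mathbb K)$, $P_c:\mathbb K^{n+1}\to c$ is the orthogonal projection. For $b,c\in\mathrm{Gr}_p(\mathbb K)$, $|\mathrm{Cos}(b,c)|:=\mathrm{Vol}_{\mathbb R}(P_c(E'))^{1/d}$, where $b$ is viewed as a $dp$-dimensional real vector space, $E'\subset b$ is a convex subset containing the zero vector and of volume one, and $\mathrm{Vol}_{\mathbb R}$ is the $dp$-dimensional Euclidean volume (the value is independent of $E'$).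
   Formalization: The second equality, with |Cos(x·b_o,b_o)|^λ, is stated under the extra hypothesis Vol_R(x(E))=1, since without it it fails: x=exp(sH_o), s≠0, fixes b_o, so |Cos|=1, while α_P(x)^λ=exp(sλpq/(n+1)). *)

(* Defs.v *)
From HB Require Import structures.
From mathcomp Require Import all_boot all_order all_algebra.
From mathcomp Require Import ring.
From mathcomp Require Import all_classical all_reals all_analysis.
From mathcomp Require Import complex.

Set Implicit Arguments.
Unset Strict Implicit.
Unset Printing Implicit Defensive.
Import Order.TTheory GRing.Theory Num.Theory.
Import numFieldNormedType.Exports.
Local Open Scope classical_set_scope.
Local Open Scope ring_scope.
Local Open Scope complex_scope.

(* Hamilton's quaternions q0 + q1 i + q2 j + q3 k. *)

Record quat (R : Type) : Type := Quat { q0 : R; q1 : R; q2 : R; q3 : R }.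

Definition seq_of_quat (R : Type) (x : quat R) : seq R :=
  [:: q0 x; q1 x; q2 x; q3 x].
Definition quat_of_seq (R : Type) (s : seq R) : option (quat R) :=
  if s is [:: a; b; c; d] then Some (Quat a b c d) else None.
Lemma seq_of_quatK (R : Type) : pcancel (@seq_of_quat R) (@quat_of_seq R).
Proof. by case. Qed.

HB.instance Definition _ (R : eqType) := Equality.copy (quat R)
  (pcan_type (@seq_of_quatK R)).
HB.instance Definition _ (R : choiceType) := Choice.copy (quat R)
  (pcan_type (@seq_of_quatK R)).

Section QuatRing.
Variable R : comNzRingType.
Implicit Types x y z : quat R.

Definition addq x y :=
  Quat (q0 x + q0 y) (q1 x + q1 y) (q2 x + q2 y) (q3 x + q3 y).
Definition oppq x := Quat (- q0 x) (- q1 x) (- q2 x) (- q3 x).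
Definition mulq x y :=
  Quat (q0 x * q0 y - q1 x * q1 y - q2 x * q2 y - q3 x * q3 y)
       (q0 x * q1 y + q1 x * q0 y + q2 x * q3 y - q3 x * q2 y)
       (q0 x * q2 y - q1 x * q3 y + q2 x * q0 y + q3 x * q1 y)
       (q0 x * q3 y + q1 x * q2 y - q2 x * q1 y + q3 x * q0 y).
Definition real_quat (t : R) := Quat t 0 0 0.
Definition conjq x := Quat (q0 x) (- q1 x) (- q2 x) (- q3 x).

Lemma addqA : associative addq.
Proof. by move=> [????] [????] [????]; congr Quat; rewrite /= addrA. Qed.
Lemma addqC : commutative addq.
Proof. by move=> [????] [????]; congr Quat; rewrite /= addrC. Qed.
Lemma add0q : left_id (real_quat 0) addq.
Proof. by move=> [????]; congr Quat; rewrite /= add0r. Qed.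
Lemma addNq : left_inverse (real_quat 0) oppq addq.
Proof. by move=> [????]; congr Quat; rewrite /= addNr. Qed.

HB.instance Definition _ :=
  GRing.isZmodule.Build (quat R) addqA addqC add0q addNq.

Lemma mulqA : associative mulq.
Proof. by move=> [????] [????] [????]; congr Quat => /=; ring. Qed.
Lemma mul1q : left_id (real_quat 1) mulq.
Proof. by move=> [????]; congr Quat => /=; ring. Qed.
Lemma mulq1 : right_id (real_quat 1) mulq.
Proof. by move=> [????]; congr Quat => /=; ring. Qed.
Lemma mulqDl : left_distributive mulq addq.
Proof. by move=> [????] [????] [????]; congr Quat => /=; ring. Qed.
Lemma mulqDr : right_distributive mulq addq.
Proof. by move=> [????] [????] [????]; congr Quat => /=; ring. Qed.
Lemma oneq_neq0 : real_quat 1 != 0.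
Proof. by apply/eqP => -[] /eqP; rewrite oner_eq0. Qed.

HB.instance Definition _ := GRing.Zmodule_isNzRing.Build (quat R)
  mulqA mul1q mulq1 mulqDl mulqDr oneq_neq0.

End QuatRing.

Inductive scalars := Reals | Complexes | Quaternions.

Definition skewfield (R : realType) (F : scalars) : nzRingType :=
  match F with
  | Reals => R
  | Complexes => R[i]
  | Quaternions => quat R
  end.

Definition rdim (F : scalars) : nat :=
  match F with Reals => 1 | Complexes => 2 | Quaternions => 4 end.

Section Realification.
Variables (R : realType) (F : scalars).
Local Notation K := (skewfield R F).
Local Notation d := (rdim F).

Definition of_real : R -> K :=
  match F return R -> skewfield R F with
  | Reals => fun t => t
  | Complexes => fun t => t%:C
  | Quaternions => fun t => real_quat t
  end.

Definition conjK : K -> K :=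
  match F return skewfield R F -> skewfield R F with
  | Reals => fun z => z
  | Complexes => fun z => conjc z
  | Quaternions => fun z => conjq z
  end.

Definition coords : K -> seq R :=
  match F return skewfield R F -> seq R with
  | Reals => fun z => [:: z]
  | Complexes => fun z => [:: complex.Re z; complex.Im z]
  | Quaternions => fun z => seq_of_quat z
  end.

Definition of_coords : seq R -> K :=
  match F return seq R -> skewfield R F with
  | Reals => fun s => s`_0
  | Complexes => fun s => s`_0 +i* s`_1
  | Quaternions => fun s => Quat s`_0 s`_1 s`_2 s`_3
  end.

(* The identification of K^m with the Euclidean space R^(m d), and back.  A
   real vector is a row vector, as is usual for lin1_mx and row spaces. *)

Definition realify m (v : 'cV[K]_m) : 'rV[R]_(m * d) :=
  mxvec (\matrix_(i < m, j < d) (coords (v i 0))`_j).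

Definition unrealify m (u : 'rV[R]_(m * d)) : 'cV[K]_m :=
  \col_i of_coords [seq vec_mx u i j | j : 'I_d].

(* The determinant of x as a real linear endomorphism of K^m. *)
Definition detR m (x : 'M[K]_m) : R :=
  \det (lin1_mx (fun u => realify (x *m unrealify u))).

Definition absdet m (x : 'M[K]_m) : R := `|detR x| `^ (d%:R^-1).

End Realification.

(* Over the quaternions, where the Leibniz determinant is meaningless, SL is
   the group of the matrices with |det x| = 1. *)
Definition SLmx (R : realType) (F : scalars) m : set 'M[skewfield R F]_m :=
  match F return set 'M[skewfield R F]_m with
  | Reals => fun x => \det (x : 'M[R]_m) = 1
  | Complexes => fun x => \det (x : 'M[R[i]]_m) = 1
  | Quaternions => fun x => absdet x = 1
  end.

Section CosTransform.
Variables (R : realType) (F : scalars).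
Local Notation K := (skewfield R F).
Local Notation d := (rdim F).

(* Matrix inverse without assuming that K is commutative. *)
Definition is_inv m (x y : 'M[K]_m) := x *m y = 1%:M /\ y *m x = 1%:M.
Definition GLmx m (x : 'M[K]_m) := exists y, is_inv x y.
Definition minv m (x : 'M[K]_m) : 'M[K]_m := xget 0 [set y | is_inv x y].

Definition adjmx m1 m2 (x : 'M[K]_(m1, m2)) : 'M[K]_(m2, m1) :=
  (map_mx (@conjK R F) x)^T.

Definition Kgrp m : set 'M[K]_m := [set x | SLmx x /\ adjmx x = minv x].

(* Exponential series of a real square matrix, entry by entry. *)
Definition expmx m (D : 'M[R]_m) : 'M[R]_m :=
  \matrix_(i, j) limn (fun N => \sum_(k < N) (k`!%:R^-1 * (D ^+ k) i j)).

(* The order n + 1 of the matrices is p + q. *)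

Section Groups.
Variables p q : nat.

Definition Ho : 'M[R]_(p + q) :=
  block_mx (q%:R / (p + q)%:R)%:M 0 0 (- (p%:R / (p + q)%:R))%:M.

Definition expHo (s : R) : 'M[K]_(p + q) := map_mx (@of_real R F) (expmx (s *: Ho)).

Definition Agrp : set 'M[K]_(p + q) := range expHo.

Definition Mgrp : set 'M[K]_(p + q) :=
  [set x | SLmx x /\ exists (a : 'M[K]_p) (b : 'M[K]_q),
     [/\ GLmx a, GLmx b, absdet a = 1, absdet b = 1 & x = block_mx a 0 0 b]].

Definition Ngrp : set 'M[K]_(p + q) :=
  range (fun X : 'M[K]_(p, q) => block_mx 1%:M X 0 1%:M).

Definition Nbar : set 'M[K]_(p + q) :=
  range (fun Y : 'M[K]_(q, p) => block_mx 1%:M 0 Y 1%:M).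

Definition has_A_part (x a : 'M[K]_(p + q)) :=
  Agrp a /\ exists nb m n,
    [/\ Nbar nb, Mgrp m, Ngrp n & x = nb *m m *m a *m n].

Definition NbarP : set 'M[K]_(p + q) := [set x | exists a, has_A_part x a].

Definition alphaP (x : 'M[K]_(p + q)) : 'M[K]_(p + q) :=
  xget 0 [set a | has_A_part x a].

End Groups.

Definition cexp (z : R[i]) : R[i] :=
  (expR (complex.Re z) * cos (complex.Im z))
  +i* (expR (complex.Re z) * sin (complex.Im z)).

(* t^l for real t > 0; only such t are relevant. *)
Definition cpow (t : R) (l : R[i]) : R[i] := cexp (l * (ln t)%:C).

(* a^l for a = exp (s Ho), s being unique. *)
Definition Apow p q (a : 'M[K]_(p + q)) (l : R[i]) : R[i] :=
  let s := xget 0 [set s | a = expHo p q s] in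
  cexp (s%:C * l * ((p * q)%:R / (p + q)%:R)).

(* Grassmannian of the p-dimensional right K-subspaces of K^m: the ranges of
   the injective right linear maps from K^p to K^m. *)
Definition Gr p m : set (set 'cV[K]_m) :=
  [set b | exists B : 'M[K]_(m, p),
     (forall u : 'cV[K]_p, B *m u = 0 -> u = 0) /\
     b = range (fun u : 'cV[K]_p => B *m u)].

(* The span of the first p vectors of the standard basis. *)
Definition bo p q : set 'cV[K]_(p + q) :=
  range (fun u : 'cV[K]_p => col_mx u (0 : 'cV[K]_q)).

Definition gract m (x : 'M[K]_m) (b : set 'cV[K]_m) : set 'cV[K]_m :=
  mulmx x @` b.

(* Orthogonality is for the form (w, v) |-> w^* v. *)
Definition orthproj m (c : set 'cV[K]_m) (v : 'cV[K]_m) : 'cV[K]_m :=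
  xget 0 [set w | c w /\ forall u, c u -> adjmx u *m (v - w) = 0].

(* Lebesgue outer measure on R^k, which is Lebesgue measure on measurable
   sets.  Convex sets are Lebesgue measurable but need not be Borel. *)

Definition box k (ab : 'rV[R]_k * 'rV[R]_k) : set 'rV[R]_k :=
  [set u | forall i, ab.1 0 i <= u 0 i <= ab.2 0 i].

Definition box_vol k (ab : 'rV[R]_k * 'rV[R]_k) : R :=
  \prod_i (ab.2 0 i - ab.1 0 i).

Definition lebesgue_outer k (S : set 'rV[R]_k) : \bar R :=
  ereal_inf [set (\sum_(0 <= j <oo) (box_vol (ab j))%:E)%E |
    ab in [set ab : nat -> 'rV[R]_k * 'rV[R]_k |
      (forall j i, (ab j).1 0 i <= (ab j).2 0 i) /\
      S `<=` \bigcup_j box (ab j)]].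

(* k-dimensional Euclidean volume of a subset S of R^N contained in a
   k-dimensional linear subspace: the volume of S in the coordinates of an
   orthonormal family of k vectors, the rows of Q, whose span contains S.  The
   value does not depend on Q. *)

Definition frame_of k N (S : set 'rV[R]_N) (Q : 'M[R]_(k, N)) :=
  Q *m Q^T = 1%:M /\ S `<=` range (fun u : 'rV[R]_k => u *m Q).

Definition vol k N (S : set 'rV[R]_N) : \bar R :=
  let Q : 'M[R]_(k, N) := xget 0 [set Q | frame_of S Q] in
  lebesgue_outer [set u : 'rV[R]_k | S (u *m Q)].

(* The volume Vol_R of subsets of p-dimensional subspaces of K^m. *)
Definition VolR p m (S : set 'cV[K]_m) : \bar R :=
  vol (d * p) (@realify R F m @` S).

Definition convexK m (S : set 'cV[K]_m) :=
  convex_set (@realify R F m @` S : set (convex_lmodType 'rV[R]_(m * d))).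

Definition unit_convex p m (b S : set 'cV[K]_m) :=
  [/\ S `<=` b, convexK S, S 0 & VolR p S = 1%E].

(* |Cos(b, c)| for b, c in Gr p m; the value does not depend on S. *)
Definition absCos p m (b c : set 'cV[K]_m) : R :=
  xget 0 [set t | exists S, unit_convex p b S /\
                  t = (fine (VolR p (orthproj c @` S))) `^ (d%:R^-1)].

End CosTransform.

Arguments bo R F p q : clear implicits.

(* Main.v *)
Require Import Defs.
From HB Require Import structures.
From mathcomp Require Import all_boot all_order all_algebra.
From mathcomp Require Import ring.
From mathcomp Require Import all_classical all_reals all_analysis.
From mathcomp Require Import complex.
Import Order.TTheory GRing.Theory Num.Theory.
Local Open Scope classical_set_scope.
Local Open Scope ring_scope.
Local Open Scope complex_scope.

(** Write I for the inclusion of K^p onto the first p coordinates of K^(p+q),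
    so that the base point b_o is the range of I, and x11 = I^* x I for the
    upper left p x p block of x.  Everything is governed by the real number
    |det_R x11|.

    On the group side, multiply out x = nbar m a n with a = exp (s H_o): since
    n fixes b_o pointwise and nbar does not change the first p coordinates of
    a vector of b_o, one gets x11 = e^(s q / (p+q)) m11 with |det m11| = 1.
    Hence ln |det_R x11| = d s p q / (p+q), and alpha_P(x)^l is
    |det_R x11|^(l/d) (ln_ulsubmx_NbarP, Apow_alphaP).

    On the geometric side, if the columns of H are orthonormal then the
    orthogonal projection onto the range of H is H H^* (orthproj_range).  So if
    S is the image under X of a set D of K^p, its projection is the image of D
    under H (H^* X), and its volume is |det_R (H^* X)| times that of D, because
    H is an isometry (VolR_orthproj).  With X = x I and H = I the factor is
    |det_R x11|, and with X = k I, H = h I for unitary k and h it is the same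
    quantity for h^-1 k.  The value of |Cos| is independent of the test set
    because X multiplies the volume of every D by one and the same Jacobian,
    which is 1 in both situations of the theorem (absCos_range).

    What remains is the change of variables formula for Lebesgue outer
    measure, for arbitrary sets and invertible linear maps (outer_mulmx).  It
    is a statement about upper bounds only: one for the outer measure of the
    image of a box gives, by countable subadditivity, one for the image of any
    set, and the bound for the inverse map turns the inequality into an
    equality.  For the elementary matrices, which generate GL_k, such an upper
    bound is obtained by covering the image of a box by boxes.  Two frames
    containing a set either span the same space, and then differ by an
    orthogonal matrix, or put the set in a hyperplane of both, where its
    measure is zero; so the volume does not depend on the frame chosen in its
    definition (vol_frame). *)

Set Implicit Arguments.
Unset Strict Implicit.

(** * Lebesgue outer measure on R^k *)

Section OuterMeasure.
Variables (R : realType) (k : nat).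
Implicit Types (A B : set 'rV[R]_k) (ab : 'rV[R]_k * 'rV[R]_k).
Local Notation outer := (@lebesgue_outer R k).

Definition ordered_box ab := forall i, ab.1 0 i <= ab.2 0 i.

Lemma box_vol_ge0 ab : ordered_box ab -> 0 <= box_vol ab.
Proof. by move=> o; apply: prodr_ge0 => i _; rewrite subr_ge0. Qed.

Lemma le_outer A B : A `<=` B -> (outer A <= outer B)%E.
Proof.
move=> AB; apply: ereal_inf_le_tmp => _ [ab [ord cov] <-].
by exists ab => //; split=> // x /AB /cov.
Qed.

Lemma outer_ge0 A : (0 <= outer A)%E.
Proof.
apply: le_ereal_inf_tmp => _ [ab [ord _] <-].
by apply: nneseries_ge0 => n _ _; rewrite lee_fin box_vol_ge0.
Qed.

(** Countably many covers, the n-th one optimal up to e / 2^(n+1), are merged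
    into a single one along a bijection between nat * nat and nat. *)
Lemma outer_sigma_subadditive (A : nat -> set 'rV[R]_k) :
  (outer (\bigcup_n A n) <= \sum_(0 <= n <oo) outer (A n))%E.
Proof.
have [[i ioo]|] := pselect (exists i, outer (A i) = +oo%E).
  rewrite (eseries_pinfty _ _ ioo) ?leey// => n _.
  by rewrite -ltNye (lt_le_trans _ (outer_ge0 _)).
rewrite -forallNE => Aoo; apply/lee_addgt0Pr => e e0.
rewrite (le_trans _ (epsilon_trick _ _ (ltW e0)))//; last first.
  by move=> n; exact: outer_ge0.
pose P n (B : nat -> 'rV[R]_k * 'rV[R]_k) :=
  ((forall j, ordered_box (B j)) /\ A n `<=` \bigcup_j box (B j)) /\
  (\sum_(0 <= j <oo) (box_vol (B j))%:E
     <= outer (A n) + (e / (2 ^ n.+1)%:R)%:E)%E.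
have [G PG] : {G & forall n, P n (G n)}.
  apply: (@choice _ _ P) => n.
  have e'0 : 0 < e / (2 ^ n.+1)%:R by rewrite divr_gt0// ltr0n expn_gt0.
  have /(lb_ereal_inf_adherent e'0) : outer (A n) \is a fin_num.
    by rewrite ge0_fin_numE ?outer_ge0// ltey; apply/eqP; exact: Aoo.
  by move=> [_ [B oB <-] /ltW]; exists B.
have G_ge0 x : (0 <= ((fun ab => (box_vol ab)%:E) \o uncurry G) x)%E.
  by case: x => n j; rewrite lee_fin box_vol_ge0//; exact: (PG n).1.1.
apply: (@le_trans _ _
  (\esum_(i in setT) ((fun ab => (box_vol ab)%:E) \o uncurry G) i)%E).
  apply: ereal_inf_lbound => /=.
  have /card_esym/ppcard_eqP[f] := card_nat2.
  exists (uncurry G \o f).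
    split=> [i|]; first by rewrite /=; case: (f i) => n j; exact: (PG n).1.1.
    move=> t [n _ /(PG n).1.2 [j _ Gt]].
    by exists (f^-1%FUN (n, j)) => //=; rewrite invK ?inE.
  rewrite nneseries_esumT; last by move=> n; exact: G_ge0.
  by rewrite [RHS](reindex_esum setT setT f).
rewrite (_ : esum _ _ = (\sum_(0 <= i <oo)
  \sum_(0 <= j <oo) (box_vol (G i j))%:E)%E); last first.
  rewrite nneseries_esumT; last first.
    by move=> n; apply: nneseries_ge0 => m _ _; exact: (G_ge0 (n, m)).
  under [RHS]eq_esum => i _.
    rewrite nneseries_esumT; last by move=> m; exact: (G_ge0 (i, m)).
  over.
  rewrite esum_esum; last by move=> i j _ _; exact: (G_ge0 (i, j)).
  rewrite (_ : _ `*`` _ = setT); last by apply/seteqP; split.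
  by apply: eq_esum => -[].
apply: lee_nneseries => [n _ _|n _]; last exact: (PG n).2.
by apply: nneseries_ge0 => m _ _; exact: (G_ge0 (n, m)).
Qed.

Hypothesis k_gt0 : (0 < k)%N.

(** In dimension 0 the volume of a point is an empty product, hence 1; this is
    why positive dimension is assumed from here on. *)
Lemma box_vol0 (a : 'rV[R]_k) : box_vol (a, a) = 0.
Proof.
rewrite /box_vol (bigD1 (Ordinal k_gt0))//= subrr mul0r//.
Qed.

Lemma outer_box ab : ordered_box ab -> (outer (box ab) <= (box_vol ab)%:E)%E.
Proof.
move=> o; apply: ereal_inf_lbound => /=.
exists (fun n => if n == 0%N then ab else (0, 0)).
  by split=> [[|j] i //=|x xab]; exists 0%N.
rewrite nneseries_recl//=; last first.
  by move=> [|n] _; rewrite lee_fin ?box_vol_ge0// box_vol0.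
rewrite eseries0 ?adde0// => -[|n]//= _ _.
by rewrite box_vol0.
Qed.

Lemma outer0 : outer set0 = 0%E.
Proof.
apply/eqP; rewrite eq_le outer_ge0 andbT.
have := @outer_box (0, 0) (fun=> lexx _); rewrite box_vol0.
by apply: le_trans; exact: le_outer.
Qed.

Lemma outerU A B : (outer (A `|` B) <= outer A + outer B)%E.
Proof.
rewrite -bigcup2E; apply: le_trans (outer_sigma_subadditive _) _.
rewrite nneseries_recl//=; last by move=> n _; exact: outer_ge0.
rewrite (nneseries_split 1 1)/=; last by move=> n _; exact: outer_ge0.
rewrite big_nat1 /= eseries0 ?adde0// => -[|[|n]]//= _ _.
exact: outer0.
Qed.

(** It is enough to control the images of boxes, from above only. *)
Lemma outer_image_le (f : 'rV[R]_k -> 'rV[R]_k) (c : R) : 0 < c ->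
    (forall ab, ordered_box ab ->
       (outer (f @` box ab) <= (c * box_vol ab)%:E)%E) ->
  forall A, (outer (f @` A) <= c%:E * outer A)%E.
Proof.
move=> c0 fc A; rewrite -ereal_inf_pZl//.
apply: le_ereal_inf_tmp => _ [_ [ab [ord cov] <-] <-].
rewrite -nneseriesZl; last by move=> n _; rewrite lee_fin box_vol_ge0.
apply: (@le_trans _ _ (outer (\bigcup_n f @` box (ab n)))).
  by apply: le_outer => _ [x /cov [n _ xn] <-]; exists n => //; exists x.
apply: le_trans (outer_sigma_subadditive _) _.
apply: lee_nneseries => n _; first by move=> _; exact: outer_ge0.
by apply: fc; exact: ord.
Qed.

End OuterMeasure.

(** * Elementary matrices generate GL_n *)

Section Elementary.
Variables (K : fieldType) (n : nat).

(** Transvections (i != j) and dilatations (i = j) in one family. *)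
Definition elem_mx (t : K) (i j : 'I_n) : 'M[K]_n := 1%:M + t *: delta_mx i j.

Lemma det_elem_mx t i j : \det (elem_mx t i j) = 1 + t *+ (i == j).
Proof.
rewrite (expand_det_row _ j) (bigD1 j)//= [X in _ + X]big1 ?addr0; last first.
  move=> l lj; rewrite !mxE eq_sym (negbTE lj) andbF mulr0 addr0.
  by rewrite mul0r.
rewrite /cofactor (_ : row' j (col' j _) = 1%:M); last first.
  apply/matrixP => a b; rewrite !mxE [_ == j]eq_sym (negbTE (neq_lift _ _)).
  by rewrite andbF mulr0 addr0 (inj_eq lift_inj).
rewrite det1 mulr1 -signr_odd oddD addbb expr0 mulr1 !mxE !eqxx andbT eq_sym.
by rewrite mulr_natr.
Qed.

Lemma elem_mx_inv t i j : 1 + t *+ (i == j) != 0 ->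
  exists2 s, 1 + s *+ (i == j) != 0 & elem_mx s i j *m elem_mx t i j = 1%:M.
Proof.
have [<-|ij] := eqVneq i j; last first.
  rewrite mulr0n addr0 => _; exists (- t); first exact: oner_neq0.
  rewrite /elem_mx mulmxDl mul1mx mulmxDr mulmx1 -scalemxAl -scalemxAr.
  rewrite mul_delta_mx_cond eq_sym (negbTE ij) mulr0n !scaler0 addr0 -addrA.
  by rewrite -scalerDl subrr scale0r addr0.
rewrite /= !mulr1n => t1; exists ((1 + t)^-1 - 1).
  by rewrite addrC subrK invr_eq0.
rewrite /elem_mx mulmxDl mul1mx mulmxDr mulmx1 -scalemxAl -scalemxAr.
rewrite mul_delta_mx scalerA -addrA -!scalerDl.
rewrite -[RHS]addr0; congr (_ + _); apply/eqP; rewrite scaler_eq0.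
by apply/orP; left; apply/eqP; field.
Qed.

Variable P : 'M[K]_n -> Prop.
Hypothesis P1 : P 1%:M.
Hypothesis PM : forall A B, P A -> P B -> P (A *m B).
Hypothesis Pelem : forall t i j, 1 + t *+ (i == j) != 0 -> P (elem_mx t i j).

(** A matrix that differs from the identity in column j only is the dilatation
    given by its pivot times the product of the transvections given by its
    other entries; these all share column j, so they multiply by adding their
    off-diagonal parts. *)
Lemma column_mx_ind (x : 'cV[K]_n) j :
  1 + x j 0 != 0 -> P (1%:M + x *m delta_mx 0 j).
Proof.
move=> xj.
have sum_shear (r : seq 'I_n) :
    P (1%:M + \sum_(l <- r | l != j) x l 0 *: delta_mx l j).
  elim: r => [|l r IH]; first by rewrite big_nil addr0.
  rewrite big_cons; case: ifPn => // lj.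
  rewrite (_ : _ + _ = elem_mx (x l 0) l j *m
    (1%:M + \sum_(m <- r | m != j) x m 0 *: delta_mx m j)).
    by apply: PM => //; apply: Pelem; rewrite (negbTE lj) mulr0n addr0 oner_eq0.
  rewrite mulmxDr mulmx1 [in X in _ = _ + X]/elem_mx mulmxDl mul1mx -!addrA.
  congr (_ + (_ + _)); rewrite -scalemxAl mulmx_sumr [X in _ + _ *: X]big1.
    by rewrite scaler0 addr0.
  move=> m mj; rewrite -scalemxAr mul_delta_mx_cond.
  by rewrite eq_sym (negbTE mj) mulr0n !scaler0.
rewrite (_ : _ + _ = elem_mx (x j 0) j j *m
  (1%:M + \sum_(l | l != j) x l 0 *: delta_mx l j)).
  by apply: PM; [apply: Pelem; rewrite eqxx|exact: sum_shear].
have xE : x *m delta_mx 0 j = \sum_l x l 0 *: delta_mx l j.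
  rewrite [x in LHS]matrix_sum_delta mulmx_suml; apply: eq_bigr => l _.
  by rewrite big_ord1 -scalemxAl mul_delta_mx.
rewrite xE (bigD1 j)//= mulmxDr mulmx1 [in X in _ = _ + X]/elem_mx mulmxDl mul1mx.
rewrite -!addrA; congr (_ + (_ + _)).
rewrite -scalemxAl mulmx_sumr [X in _ + _ *: X]big1.
  by rewrite scaler0 addr0.
move=> l lj; rewrite -scalemxAr mul_delta_mx_cond.
by rewrite eq_sym (negbTE lj) mulr0n !scaler0.
Qed.

(** Gauss-Jordan elimination: the elementary matrices generate GL_n.  The
    induction is on the number of columns that differ from those of the
    identity; one of them is cleared at a time, after adding a row to the pivot
    row if the pivot vanishes. *)
Lemma unitmx_elementary_ind T : T \in unitmx -> P T.
Proof.
pose J (T : 'M[K]_n) := [set l | col l T != delta_mx l 0]%SET.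
have [m] := ubnP #|J T|; elim: m T => // m IH T.
have [J0 _ _|[j jJ]] := set_0Vmem (J T).
  suff -> : T = 1%:M by [].
  apply/matrixP => a b; have /setP/(_ b) := J0; rewrite !inE => /negbFE/eqP.
  by move/matrixP/(_ a 0); rewrite !mxE eqxx andbT.
have idcol S l : l \notin J S -> forall a, S a l = (a == l)%:R.
  by rewrite inE negbK => /eqP/matrixP + a => /(_ a 0); rewrite !mxE eqxx andbT.
have pivot S : j \in J S -> S j j != 0 -> (#|J S| < m.+1)%N -> S \in unitmx ->
    P S.
  move=> jS Sjj Sm Su.
  pose x := col j S - delta_mx j 0.
  have xE a : x a 0 = S a j - (a == j)%:R by rewrite !mxE eqxx andbT.
  clearbody x.
  have xj : 1 + x j 0 = S j j by rewrite xE eqxx addrCA addrN addr0.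
  (* S' is S with column j cleared by row operations: S = (1 + x e_j^T) S'. *)
  pose S' := S - (S j j)^-1 *: (x *m row j S).
  have S'E a b : S' a b = S a b - (S j j)^-1 * (x a ord0 * S j b).
    by rewrite !mxE big_ord1 !mxE.
  clearbody S'.
  have SE : S = (1%:M + x *m delta_mx 0 j) *m S'.
    apply/matrixP => a b; rewrite mulmxDl mul1mx -mulmxA -rowE.
    rewrite !mxE big_ord1 !mxE !S'E.
    have -> : x j 0 = S j j - 1 by rewrite -xj addrC addKr.
    by field.
  rewrite SE; apply: PM; first by apply: column_mx_ind; rewrite xj.
  apply: IH; last by move: Su; rewrite SE unitmx_mul => /andP[].
  rewrite -ltnS; apply: leq_trans Sm; rewrite ltnS; apply: proper_card.
  apply/properP; split; last first.
    exists j => //; rewrite inE negbK; apply/eqP/colP => a.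
    by rewrite mxE S'E mulrCA mulVf// mulr1 xE subKr mxE eqxx andbT.
  apply/fintype.subsetP => l; apply: contraLR => lS.
  have jl : j != l by apply: contraNneq lS => <-.
  rewrite inE negbK; apply/eqP/colP => a.
  rewrite mxE S'E !(idcol _ _ lS) (negbTE jl) !mulr0 subr0 mxE.
  by rewrite eqxx andbT.
rewrite ltnS => Tm Tu.
have [Tjj0|Tjj] := eqVneq (T j j) 0; last exact: pivot.
(* A usable row for the zero pivot: if column j were supported on the identity
   columns, T would fix it, but T maps e_j to it, so it would be e_j. *)
have [i iJ Tij] : exists2 i, i \in J T & T i j != 0.
  apply: contrapT => noi.
  have cJ l : l \in J T -> T l j = 0.
    by move=> lJ; apply/eqP/negP => /negP Tlj; apply: noi; exists l.
  have TT : T *m col j T = col j T.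
    apply/colP => a; rewrite !mxE (bigID (mem (J T)))/= big1 ?add0r; last first.
      by move=> l lJ; rewrite mxE cJ// mulr0.
    have [aJ|aJ] := boolP (a \in J T).
      rewrite cJ// big1// => l lJ; rewrite idcol// mxE.
      by rewrite (_ : (a == l) = false) ?mul0r//; apply: contraNF lJ => /eqP <-.
    rewrite (bigD1 a)//= idcol// eqxx mul1r mxE big1 ?addr0// => l /andP[lJ la].
    by rewrite idcol// eq_sym (negbTE la) mul0r.
  move: jJ; rewrite inE => /negP; apply; apply/eqP.
  by apply: (can_inj (mulKmx Tu)); rewrite TT -colE.
have ij : i != j by apply: contraNneq Tij => ->; rewrite Tjj0.
have el t : 1 + t *+ (j == i) != 0 :> K.
  by rewrite [j == i]eq_sym (negbTE ij) mulr0n addr0 oner_eq0.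
have [s ss sV] := elem_mx_inv (el 1).
rewrite -[T]mul1mx -sV -mulmxA; apply: PM; first exact: Pelem.
have E a b : (elem_mx 1 j i *m T) a b = T a b + (a == j)%:R * T i b.
  rewrite /elem_mx scale1r mulmxDl mul1mx mxE; congr (_ + _).
  rewrite mxE (bigD1 i)//= mxE eqxx andbT big1 ?addr0// => l li.
  by rewrite mxE (negbTE li) andbF mul0r.
apply: pivot.
- rewrite inE; apply/eqP => /matrixP/(_ i 0); rewrite mxE E !mxE.
  by rewrite (negbTE ij) mul0r addr0 => /eqP; rewrite (negbTE Tij).
- by rewrite E eqxx Tjj0 add0r mul1r.
- rewrite ltnS; apply: leq_trans Tm; apply: subset_leq_card.
  apply/fintype.subsetP => l; apply: contraLR => lT; rewrite inE negbK.
  apply/eqP/colP => a; rewrite mxE E !(idcol _ _ lT) !mxE eqxx andbT.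
  rewrite (_ : (i == l) = false) ?mulr0 ?addr0//.
  by apply: contraNF lT => /eqP <-.
- rewrite unitmx_mul Tu andbT unitmxE det_elem_mx unitfE; exact: el.
Qed.

End Elementary.

(** * Linear change of variables for the outer measure *)

Section OuterLinear.
Variables (R : realType) (k : nat).
Implicit Types (A : set 'rV[R]_k) (ab : 'rV[R]_k * 'rV[R]_k).
Local Notation outer := (@lebesgue_outer R k).

Lemma scale_itv (t a b u : R) : a <= u <= b ->
  Num.min (t * a) (t * b) <= t * u <= Num.max (t * a) (t * b).
Proof.
move=> /andP[au ub]; rewrite ge_min le_max; have [t0|t0] := leP 0 t.
  by rewrite (ler_wpM2l t0 au) (ler_wpM2l t0 ub) orbT.
by rewrite (ler_wnM2l (ltW t0) au) (ler_wnM2l (ltW t0) ub) orbT.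
Qed.

Lemma scale_itv_length (t a b : R) : a <= b ->
  Num.max (t * a) (t * b) - Num.min (t * a) (t * b) = `|t| * (b - a).
Proof.
move=> ab; have [t0|t0] := leP 0 t.
  have le : t * a <= t * b by rewrite ler_wpM2l.
  by rewrite (max_idPr le) (min_idPl le) ger0_norm// mulrBr.
have le : t * b <= t * a by rewrite (ler_wnM2l (ltW t0)).
by rewrite (max_idPl le) (min_idPr le) ltr0_norm//; ring.
Qed.

Lemma mul_elem_mxE t (i j : 'I_k) (u : 'rV[R]_k) l :
  (u *m elem_mx t i j) 0 l = u 0 l + (t * u 0 i) *+ (l == j).
Proof.
rewrite /elem_mx mulmxDr mulmx1 -scalemxAr !mxE; congr (_ + _).
rewrite (bigD1 i)//= !mxE eqxx /= big1 ?addr0; last first.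
  by move=> m mi; rewrite !mxE (negbTE mi) mulr0.
by rewrite mulrA mulr_natr.
Qed.

Lemma outer_scaled_box (t : R) (i : 'I_k) ab : 1 + t != 0 -> ordered_box ab ->
  (outer (mulmx^~ (elem_mx t i i) @` box ab)
     <= (`|1 + t| * box_vol ab)%:E)%E.
Proof.
move=> t0 ordab.
pose s l := if l == i then 1 + t else 1.
pose lo := \row_l Num.min (s l * ab.1 0 l) (s l * ab.2 0 l).
pose hi := \row_l Num.max (s l * ab.1 0 l) (s l * ab.2 0 l).
have lohi : ordered_box (lo, hi) by move=> l; rewrite !mxE le_max !ge_min lexx.
have -> : `|1 + t| * box_vol ab = box_vol (lo, hi).
  have sE l : hi 0 l - lo 0 l = `|s l| * (ab.2 0 l - ab.1 0 l).
    by rewrite !mxE scale_itv_length.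
  rewrite /box_vol; under [RHS]eq_bigr => l _ do rewrite sE.
  rewrite big_split/=; congr (_ * _); rewrite (bigD1 i)//= big1 ?mulr1.
    by rewrite /s eqxx.
  by move=> l li; rewrite /s (negbTE li) normr1.
apply: le_trans (outer_box _ lohi); last by case: k i {ab s lo hi ordab lohi} => [[]|].
apply: le_outer => _ [u uab <-] l; rewrite mul_elem_mxE.
have -> : u 0 l + (t * u 0 i) *+ (l == i) = s l * u 0 l.
  rewrite /s; case: eqVneq => [->|_]; first by rewrite mulr1n mulrDl mul1r.
  by rewrite mulr0n addr0 mul1r.
by rewrite !mxE /=; apply: scale_itv.
Qed.

(** The volume by which the smallest box containing the image of ab under the
    shear exceeds the volume of ab. *)
Definition shear_excess (t : R) (i j : 'I_k) ab : R :=
  `|t| * (ab.2 0 i - ab.1 0 i) * \prod_(l | l != j) (ab.2 0 l - ab.1 0 l).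

Lemma outer_sheared_box_excess (t : R) (i j : 'I_k) ab : i != j ->
    ordered_box ab ->
  (outer (mulmx^~ (elem_mx t i j) @` box ab)
     <= (box_vol ab + shear_excess t i j ab)%:E)%E.
Proof.
move=> ij ordab.
pose m := Num.min (t * ab.1 0 i) (t * ab.2 0 i).
pose M := Num.max (t * ab.1 0 i) (t * ab.2 0 i).
pose lo := \row_l (ab.1 0 l + m *+ (l == j)).
pose hi := \row_l (ab.2 0 l + M *+ (l == j)).
have mM : M - m = `|t| * (ab.2 0 i - ab.1 0 i) by rewrite scale_itv_length.
have m_le_M : m <= M by rewrite le_max !ge_min lexx.
have lohi : ordered_box (lo, hi).
  by move=> l; rewrite !mxE lerD// lerMn2r m_le_M orbT.
have -> : box_vol ab + shear_excess t i j ab = box_vol (lo, hi).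
  rewrite /box_vol /shear_excess -mM (bigD1 j)//= [RHS](bigD1 j)//=.
  under [in RHS]eq_bigr => l lj do rewrite !mxE (negbTE lj) !mulr0n !addr0.
  by rewrite !mxE eqxx !mulr1n; ring.
apply: le_trans (outer_box _ lohi); last exact: (leq_trans _ (ltn_ord i)).
apply: le_outer => _ [u uab <-] l; rewrite mul_elem_mxE /= !mxE.
have /andP[au ub] := uab l; have /andP[mu uM] := scale_itv t (uab i).
by apply/andP; split; apply: lerD => //; rewrite lerMn2r ?mu ?uM orbT.
Qed.

(** A shear does not increase volume.  Bisecting the box along coordinate i
    halves the volume of each piece but divides its excess by 4, so n
    successive bisections divide the total excess by 2^n. *)
Lemma outer_sheared_box (t : R) (i j : 'I_k) ab : i != j -> ordered_box ab ->
  (outer (mulmx^~ (elem_mx t i j) @` box ab) <= (box_vol ab)%:E)%E.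
Proof.
move=> ij ordab.
pose f := mulmx^~ (elem_mx t i j) : 'rV[R]_k -> 'rV[R]_k.
have k_gt0 : (0 < k)%N by exact: (leq_trans _ (ltn_ord i)).
have bisect n : forall cd, ordered_box cd ->
    (outer (f @` box cd) <= (box_vol cd + shear_excess t i j cd / 2 ^+ n)%:E)%E.
  elim: n => [|n IH] cd ordcd.
    by rewrite expr0 divr1; exact: outer_sheared_box_excess.
  pose mid := (cd.1 0 i + cd.2 0 i) / 2.
  pose upd (v : 'rV[R]_k) := \row_l (if l == i then mid else v 0 l).
  have halved (ef : 'rV[R]_k * 'rV[R]_k) :
      (forall l, ef.2 0 l - ef.1 0 l =
         (cd.2 0 l - cd.1 0 l) * (if l == i then 2^-1 else 1)) ->
      ordered_box ef /\ (outer (f @` box ef) <=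
        ((box_vol cd + shear_excess t i j cd / 2 ^+ n.+1) / 2)%:E)%E.
    move=> w; have ordef : ordered_box ef.
      move=> l; rewrite -subr_ge0 w mulr_ge0 ?subr_ge0//.
      by case: ifP => // _; rewrite invr_ge0.
    split=> //; apply: le_trans (IH _ ordef) _; rewrite lee_fin.
    have prodw (P : pred 'I_k) : P i ->
        \prod_(l | P l) (ef.2 0 l - ef.1 0 l) =
        (\prod_(l | P l) (cd.2 0 l - cd.1 0 l)) / 2.
      move=> Pi; under eq_bigr => l _ do rewrite w.
      rewrite big_split/=; congr (_ * _); rewrite (bigD1 i)//= eqxx.
      by rewrite big1 ?mulr1// => l /andP[_ li]; rewrite (negbTE li).
    rewrite /box_vol /shear_excess !prodw// w eqxx exprS.
    rewrite le_eqVlt; apply/orP; left; apply/eqP; field.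
    by rewrite expf_neq0.
  have [lo olo] : ordered_box (cd.1, upd cd.2) /\
      (outer (f @` box (cd.1, upd cd.2)) <=
        ((box_vol cd + shear_excess t i j cd / 2 ^+ n.+1) / 2)%:E)%E.
    apply: halved => l; rewrite /= mxE; case: eqP => [->|_]; last by rewrite mulr1.
    by rewrite /mid; field.
  have [hi ohi] : ordered_box (upd cd.1, cd.2) /\
      (outer (f @` box (upd cd.1, cd.2)) <=
        ((box_vol cd + shear_excess t i j cd / 2 ^+ n.+1) / 2)%:E)%E.
    apply: halved => l; rewrite /= mxE; case: eqP => [->|_]; last by rewrite mulr1.
    by rewrite /mid; field.
  apply: (@le_trans _ _
    (outer (f @` box (cd.1, upd cd.2) `|` f @` box (upd cd.1, cd.2)))).
    apply: le_outer => _ [u ucd <-].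
    have [umid|umid] := leP (u 0 i) mid; [left|right]; exists u => // l;
      rewrite /= mxE; have /andP[cu ud] := ucd l.
      by rewrite cu /=; case: eqP => // ->.
    by rewrite ud andbT; case: eqP => // ->; exact: ltW.
  apply: le_trans (outerU k_gt0 _ _) _; apply: le_trans (leeD olo ohi) _.
  by rewrite -EFinD lee_fin -splitr.
apply/lee_addgt0Pr => e e0.
have ex0 : 0 <= shear_excess t i j ab.
  rewrite !mulr_ge0 ?subr_ge0//.
  by apply: prodr_ge0 => l _; rewrite subr_ge0.
pose n := (Num.truncn (shear_excess t i j ab / e)).+1.
apply: le_trans (bisect n _ ordab) _; rewrite -EFinD lee_fin lerD2l.
rewrite ler_pdivrMr ?exprn_gt0// mulrC -ler_pdivrMr//.
apply: (@le_trans _ _ n%:R).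
  by apply: ltW; exact: truncnS_gt.
by rewrite -natrX ler_nat ltnW// ltn_expl.
Qed.

(** The bound is multiplicative in T, so elementary matrices suffice. *)
Lemma outer_mulmx_le (T : 'M[R]_k) A : T \in unitmx ->
  (outer (mulmx^~ T @` A) <= `|\det T|%:E * outer A)%E.
Proof.
move=> Tu; move: T Tu A; apply: unitmx_elementary_ind.
- move=> A; rewrite det1 normr1 mul1e; apply: le_outer => _ [u Au <-].
  by rewrite mulmx1.
- move=> S T PS PT A; rewrite det_mulmx normrM.
  apply: (@le_trans _ _ (outer (mulmx^~ T @` (mulmx^~ S @` A)))).
    apply: le_outer => _ [u Au <-]; exists (u *m S); first by exists u.
    by rewrite mulmxA.
  apply: le_trans (PT _) _; rewrite mulrC EFinM -muleA.
  by apply: lee_wpmul2l; [rewrite lee_fin|exact: PS].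
- move=> t i j tij A; rewrite det_elem_mx; move: tij.
  have k_gt0 : (0 < k)%N by exact: (leq_trans _ (ltn_ord i)).
  have [<-|ij] := eqVneq i j => /= tij.
    apply: outer_image_le => [|ab ordab]; first by rewrite normr_gt0.
    exact: outer_scaled_box.
  rewrite addr0 normr1; apply: outer_image_le => // ab ordab.
  by rewrite mul1r; exact: outer_sheared_box.
Qed.

(** Change of variables: the bound for T and the bound for its inverse have
    reciprocal constants, so both are equalities. *)
Lemma outer_mulmx (T : 'M[R]_k) A : T \in unitmx ->
  outer (mulmx^~ T @` A) = (`|\det T|%:E * outer A)%E.
Proof.
move=> Tu; apply/eqP; rewrite eq_le outer_mulmx_le//=.
have dT : 0 < `|\det T| by rewrite normr_gt0 -unitfE -unitmxE.
have AE : mulmx^~ (invmx T) @` (mulmx^~ T @` A) = A.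
  rewrite image_comp -[RHS]image_id; apply: eq_imagel => u _ /=.
  by rewrite mulmxK.
have Vu : invmx T \in unitmx by rewrite unitmx_inv.
have := outer_mulmx_le (mulmx^~ T @` A) Vu.
rewrite AE det_inv normfV => /(lee_wpmul2l (_ : 0%E <= `|\det T|%:E)%E).
move=> /(_ (ltW dT)); rewrite muleA -EFinM divff ?gt_eqF// mul1e.
by apply.
Qed.

(** Elimination on the single column M is a linear change of variables that
    maps the hyperplane u M = 0 into a coordinate hyperplane, which is a
    countable union of boxes with one side of length 0. *)
Lemma outer_kernel (M : 'cV[R]_k) A : M != 0 ->
  (forall u, A u -> u *m M = 0) -> outer A = 0%E.
Proof.
move=> M0 AM.
have k_gt0 : (0 < k)%N.
  by case: k M M0 {AM A} => // M; rewrite [M]flatmx0 eqxx.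
have [i Mi] : exists i, M i 0 != 0.
  by apply/existsP; apply: contraNT M0; rewrite negb_exists => /forallP H;
    apply/eqP/colP => i; move: (H i); rewrite negbK mxE => /eqP.
have rM : \rank M = 1%N.
  by apply/eqP; rewrite eqn_leq rank_leq_col lt0n mxrank_eq0.
have AL : outer (mulmx^~ (col_ebase M) @` A) = 0%E.
  apply/eqP; rewrite eq_le outer_ge0 andbT.
  pose i0 := Ordinal k_gt0.
  pose side (n : nat) := \row_(l < k) (n%:R *+ (l != i0)) : 'rV[R]_k.
  apply: (@le_trans _ _ (outer (\bigcup_n box (- side n, side n)))).
    apply: le_outer => _ [u /AM uM <-].
    have u0 : (u *m col_ebase M) 0 i0 = 0.
      have /matrixP/(_ 0 0) : u *m col_ebase M *m (pid_mx 1 : 'cV_k) = 0.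
        apply: (can_inj (mulmxK (row_ebase_unit M))).
        have ME := mulmx_ebase M; rewrite rM in ME.
        by rewrite mul0mx -[u *m _ *m _]mulmxA -mulmxA ME.
      rewrite mxE (bigD1 i0)//= [X in _ + X]big1.
        by rewrite !mxE /= mulr1 addr0.
      move=> l li; rewrite [pid_mx _ _ _]mxE (_ : _ && _ = false) ?mulr0//.
      by apply: contraNF li => /andP[/eqP ll _]; apply/eqP/val_inj.
    move: (u *m col_ebase M) u0 => v u0.
    (* The n-th box has half-side n in every direction but i0, where it is flat. *)
    exists (Num.truncn (\sum_l `|v 0 l|)).+1 => // l.
    rewrite /= !mxE -ler_norml; case: eqVneq => [->|_]; first by rewrite u0 normr0.
    rewrite mulr1n; apply: le_trans (ltW (truncnS_gt _)).
    by rewrite (bigD1 l)//= lerDl sumr_ge0.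
  apply: le_trans (outer_sigma_subadditive _) _; rewrite eseries0// => n _ _.
  apply/eqP; rewrite eq_le outer_ge0 andbT.
  apply: le_trans (outer_box k_gt0 _) _.
    move=> l; rewrite !mxE -subr_ge0 opprK.
    by rewrite addr_ge0// mulrn_wge0.
  by rewrite lee_fin /box_vol (bigD1 i0)//= !mxE eqxx mulr0n oppr0 subrr mul0r.
have := outer_mulmx A (col_ebase_unit M); rewrite AL => /esym/eqP.
rewrite mule_eq0 => /orP[|/eqP//].
by rewrite eqe normr_eq0 -[_ == _]negbK -unitfE -unitmxE col_ebase_unit.
Qed.

End OuterLinear.

(** * Volume in subspaces of a Euclidean space *)

Section Frames.
Variable R : realType.

Lemma mulmx_tr_gt0 N (w : 'rV[R]_N) : w != 0 -> 0 < (w *m w^T) 0 0.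
Proof.
move=> w0; rewrite mxE lt_neqAle sumr_ge0 ?andbT; last first.
  by move=> i _; rewrite mxE -expr2 sqr_ge0.
apply: contraNneq w0 => /esym/eqP; rewrite psumr_eq0; last first.
  by move=> i _; rewrite mxE -expr2 sqr_ge0.
move=> /allP w0; apply/eqP/rowP => i; rewrite mxE; apply/eqP.
by have := w0 i (mem_index_enum _); rewrite mxE -expr2 sqrf_eq0.
Qed.

(** Frames exist: the new vector is the first row minus its projection onto the
    span of the others, normalized; it is nonzero by independence. *)
Lemma gram_schmidt k N (B : 'M[R]_(k, N)) : row_free B ->
  exists2 G : 'M[R]_k, G \in unitmx &
    exists2 Q : 'M[R]_(k, N), Q *m Q^T = 1%:M & B = G *m Q.
Proof.
elim: k B => [|k IH]; last rewrite -[k.+1]/(1 + k)%N; move=> B Bfree.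
  exists 1%:M; first exact: unitmx1.
  by exists B; rewrite ?mul1mx// [LHS]flatmx0 [RHS]flatmx0.
pose b := usubmx B; pose B' := dsubmx B.
have BE : B = col_mx b B' by rewrite vsubmxK.
have [|G' G'u [Q' QQ' BE']] := IH B'.
  apply: inj_row_free => v vB'.
  have : row_mx 0 v *m B = 0 :> 'rV_N by rewrite BE mul_row_col mul0mx add0r.
  rewrite -(mul0mx _ B) => /(row_free_inj Bfree).
  by rewrite -row_mx0 => /eq_row_mx[].
pose w := b - b *m Q'^T *m Q'.
have wQ' : w *m Q'^T = 0.
  by rewrite mulmxBl -!mulmxA QQ' mulmx1 subrr.
have w0 : w != 0.
  apply/eqP => w0.
  have : row_mx 1%:M (- (b *m Q'^T *m invmx G')) *m B = 0 :> 'rV_N.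
    rewrite BE mul_row_col mul1mx mulNmx BE' -!mulmxA (mulKmx G'u).
    by rewrite mulmxA.
  rewrite -(mul0mx _ B) => /(row_free_inj Bfree).
  rewrite -row_mx0 => /eq_row_mx[/matrixP/(_ 0 0)/eqP].
  by rewrite !mxE oner_eq0.
have ww := mulmx_tr_gt0 w0; set s2 := (_ *m _) _ _ in ww.
pose s := Num.sqrt s2; have s_gt0 : 0 < s by rewrite sqrtr_gt0.
exists (block_mx s%:M (b *m Q'^T) 0 G' : 'M[R]_(1 + k)).
  by rewrite unitmxE det_ublock unitrM -(unitmxE G') G'u andbT det_scalar1 unitfE gt_eqF.
exists (col_mx (s^-1 *: w) Q' : 'M[R]_(1 + k, N)); last first.
  rewrite BE mul_block_col mul0mx add0r -BE'; congr col_mx.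
  rewrite mul_scalar_mx scalerA divff ?gt_eqF// scale1r.
  by rewrite subrK.
rewrite tr_col_mx mul_col_row [RHS](@scalar_mx_block _ 1 k); congr block_mx => //.
- rewrite linearZ/= -scalemxAl -scalemxAr scalerA [w *m w^T]mx11_scalar -/s2.
  rewrite scale_scalar_mx -(sqr_sqrtr (ltW ww)) -/s; congr (_%:M).
  by field; rewrite gt_eqF.
- by rewrite -scalemxAl wQ' scaler0.
- by rewrite linearZ/= -scalemxAr -[Q' *m _]trmxK trmx_mul trmxK wQ' trmx0 scaler0.
Qed.

(** The change of coordinates between the two frames is T = Q Q'^T.  If T is
    orthogonal it preserves the measure.  Otherwise every coordinate vector of
    S is fixed by T T^T <> 1, so S lies in a hyperplane and has measure 0. *)
Lemma outer_frame_le k N (S : set 'rV[R]_N) (Q Q' : 'M[R]_(k, N)) :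
    frame_of S Q -> frame_of S Q' ->
  (lebesgue_outer [set u : 'rV[R]_k | S (u *m Q)]
     <= lebesgue_outer [set u : 'rV[R]_k | S (u *m Q')])%E.
Proof.
move=> [QQ _] [QQ' SQ'].
pose T := Q *m Q'^T.
set A := (X in (lebesgue_outer X <= _)%E); set A' := (X in (_ <= lebesgue_outer X)%E).
have AT u : A u -> u *m T *m Q' = u *m Q.
  by move=> /SQ' [u' _ eu]; rewrite /T mulmxA -eu -!mulmxA [Q' *m _]mulmxA QQ' mul1mx.
have ATT u : A u -> u *m (T *m T^T) = u.
  move=> /AT uT; have -> : T^T = Q' *m Q^T by rewrite trmx_mul trmxK.
  rewrite 2!mulmxA uT.
  by rewrite -mulmxA QQ mulmx1.
have [TT|] := eqVneq (T *m T^T) 1%:M.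
  have Tu : T \in unitmx by case: (mulmx1_unit TT).
  have dT : `|\det T| = 1.
    have /(congr1 (@determinant _ _)) := TT; rewrite det_mulmx det_tr det1 -expr2.
    by move=> dT; rewrite -sqrtr_sqr dT sqrtr1.
  rewrite -[leLHS]mul1e -dT -(outer_mulmx _ Tu); apply: le_outer => _ [u Au <-].
  by rewrite /A' /= AT.
rewrite -subr_eq0 => TT1.
have [j cj] : exists j, col j (T *m T^T - 1%:M) != 0.
  apply/existsP; apply: contraNT TT1; rewrite negb_exists => /forallP H.
  apply/eqP/matrixP => a j; have := H j; rewrite negbK => /eqP/colP/(_ a).
  by rewrite [LHS]mxE => ->; rewrite !mxE.
rewrite (outer_kernel cj) ?outer_ge0// => u Au.
by rewrite colE mulmxA mulmxBr ATT// mulmx1 subrr mul0mx.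
Qed.

Lemma vol_frame k N (S : set 'rV[R]_N) (Q : 'M[R]_(k, N)) : frame_of S Q ->
  vol k S = lebesgue_outer [set u : 'rV[R]_k | S (u *m Q)].
Proof.
move=> SQ; have SQ0 := @xgetPex _ 0 [set Q | frame_of S Q] (ex_intro _ Q SQ).
by apply/eqP; rewrite /vol eq_le !outer_frame_le.
Qed.

(** The dimensions k and k' are kept apart because volumes in K^m are taken in
    dimension d * p whereas K^p is realified as R^(p * d). *)
Lemma vol_mulmx k k' N (B : 'M[R]_(k', N)) (A : set 'rV[R]_k') : k = k' ->
    row_free B ->
  vol k (mulmx^~ B @` A)
    = ((Num.sqrt (\det (B *m B^T)))%:E * lebesgue_outer A)%E.
Proof.
move=> ek; subst k' => /gram_schmidt[G Gu [Q QQ BE]].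
have frameQ : frame_of (mulmx^~ B @` A) Q.
  by split=> // _ [u _ <-]; exists (u *m G) => //; rewrite BE mulmxA.
rewrite (vol_frame frameQ) BE trmx_mul mulmxA -(mulmxA G) QQ mulmx1.
rewrite det_mulmx det_tr -expr2 sqrtr_sqr -(outer_mulmx _ Gu); congr lebesgue_outer.
apply/seteqP; split=> [u /= [v Av]|_ [v Av <-]] /=.
  rewrite mulmxA => vu; exists v => //.
  by rewrite -[u]mulmx1 -QQ mulmxA -vu -mulmxA QQ mulmx1.
by exists v => //; rewrite mulmxA.
Qed.

End Frames.

(** * The skew fields R, C, H and the realification of matrices *)

Section Scalars.
Variables (R : realType) (F : scalars).
Local Notation K := (skewfield R F).
Local Notation d := (rdim F).
Implicit Types (x y z : K) (t : R).

Lemma rdim_gt0 : (0 < d)%N.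
Proof. by case: F. Qed.

Lemma coordsD x y j : (coords (x + y))`_j = (coords x)`_j + (coords y)`_j.
Proof.
move: x y; case: F => /= [x y|[a b] [a' b']|x y].
- by case: j => [|[]] //=; rewrite addr0.
- by case: j => [|[|[]]] //=; rewrite addr0.
- by case: j => [|[|[|[|[]]]]] //=; rewrite addr0.
Qed.

Lemma coordsZ t x j : (coords (of_real F t * x))`_j = t * (coords x)`_j.
Proof.
move: x; case: F => /= [x|[a b]|x].
- by case: j => [|[]] //=; rewrite mulr0.
- by case: j => [|[|[]]] //=; rewrite ?mul0r ?mulr0 ?subr0 ?addr0 ?add0r.
- by case: j => [|[|[|[|[]]]]] //=; rewrite ?mul0r ?mulr0 ?subr0 ?addr0 ?add0r.
Qed.

Lemma size_coords x : size (coords x) = d.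
Proof. by move: x; case: F. Qed.

Lemma coordsK x : of_coords F (coords x) = x.
Proof. by move: x; case: F => //= -[]. Qed.

Lemma of_coordsK (s : seq R) : size s = d -> coords (of_coords F s) = s.
Proof.
case: F => /=.
- by case: s => [|a []].
- by case: s => [|a [|b []]].
- by case: s => [|a [|b [|c [|e []]]]].
Qed.

Lemma of_real_comm t x : of_real F t * x = x * of_real F t.
Proof.
move: x; case: F => /= x; [exact: mulrC|exact: mulrC|].
by case: x => a b c e; congr Quat => /=; ring.
Qed.

Lemma of_real1 : of_real F 1 = 1 :> K.
Proof. by case: F. Qed.

Lemma of_real0 : of_real F 0 = 0 :> K.
Proof. by case: F. Qed.

Lemma conjKD x y : conjK (x + y) = conjK x + conjK y.
Proof.
move: x y; case: F => //= [[a b] [a' b']|[a b c e] [a' b' c' e']].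
  by apply/eqP; rewrite eq_complex /= opprD !eqxx.
by congr Quat => /=; rewrite opprD.
Qed.

Lemma conjK0 : conjK 0 = 0 :> K.
Proof.
case: F => //=; first by apply/eqP; rewrite eq_complex /= oppr0 !eqxx.
by congr Quat; rewrite oppr0.
Qed.

Lemma conjK1 : conjK 1 = 1 :> K.
Proof.
case: F => //=; first by apply/eqP; rewrite eq_complex /= oppr0 !eqxx.
by congr Quat; rewrite oppr0.
Qed.

Lemma conjKM x y : conjK (x * y) = conjK y * conjK x.
Proof.
move: x y; case: F => /= [x y|[a b] [a' b']|[a b c e] [a' b' c' e']].
- exact: mulrC.
- by apply/eqP; rewrite eq_complex /=; apply/andP; split; apply/eqP; ring.
- by congr Quat => /=; ring.
Qed.

Lemma conjKK : involutive (@conjK R F).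
Proof.
case: F => //= [[a b]|[a b c e]]; last by congr Quat => /=; rewrite opprK.
by apply/eqP; rewrite eq_complex /= opprK !eqxx.
Qed.

(** The Euclidean inner product on K = R^d is the real part of conj x * y; for
    d = 1, 2, 4 the 0-th coordinate is the real part. *)
Lemma coords_dot x y :
  \sum_(j < d) (coords x)`_j * (coords y)`_j = (coords (conjK x * y))`_0.
Proof.
move: x y; case: F => /= [x y|[a b] [a' b']|[a b c e] [a' b' c' e']].
- by rewrite big_ord1.
- by rewrite !big_ord_recl big_ord0 /=; ring.
- by rewrite !big_ord_recl big_ord0 /=; ring.
Qed.

End Scalars.

Section Adjoint.
Variables (R : realType) (F : scalars).
Local Notation K := (skewfield R F).

Lemma adjmx_mul m n p (X : 'M[K]_(m, n)) (Y : 'M[K]_(n, p)) :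
  adjmx (X *m Y) = adjmx Y *m adjmx X.
Proof.
apply/matrixP => i j; rewrite !mxE.
rewrite (big_morph (@conjK R F) (@conjKD R F) (@conjK0 R F)).
by apply: eq_bigr => l _; rewrite !mxE conjKM.
Qed.

Lemma adjmxK m n (X : 'M[K]_(m, n)) : adjmx (adjmx X) = X.
Proof. by apply/matrixP => i j; rewrite !mxE conjKK. Qed.

Lemma adjmx1 n : adjmx 1%:M = 1%:M :> 'M[K]_n.
Proof.
apply/matrixP => i j; rewrite !mxE eq_sym.
by case: eqVneq => _; rewrite ?conjK0 ?conjK1.
Qed.

Lemma adjmx0 m n : adjmx 0 = 0 :> 'M[K]_(m, n).
Proof. by apply/matrixP => i j; rewrite !mxE conjK0. Qed.

(** Testing a vector against the standard basis for the form (w, v) |-> w^* v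
    reads off its coordinates. *)
Lemma adj_delta_mul m n (i : 'I_m) (X : 'M[K]_(m, n)) :
  adjmx (delta_mx i 0 : 'cV[K]_m) *m X = row i X.
Proof.
rewrite rowE; congr (_ *m _); apply/matrixP => a b; rewrite !mxE andbC.
by case: (_ && _); rewrite ?conjK0 ?conjK1.
Qed.

End Adjoint.

Section RealMatrix.
Variables (R : realType) (F : scalars).
Local Notation K := (skewfield R F).
Local Notation d := (rdim F).

Lemma realifyD m (v w : 'cV[K]_m) : realify (v + w) = realify v + realify w.
Proof.
rewrite /realify -linearD; congr mxvec; apply/matrixP => i j.
by rewrite !mxE coordsD.
Qed.

Lemma realify0 m : realify (0 : 'cV[K]_m) = 0.
Proof. by apply: (addrI (realify (0 : 'cV[K]_m))); rewrite -realifyD !addr0. Qed.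

Lemma realifyZ m t (v : 'cV[K]_m) : realify (of_real F t *: v) = t *: realify v.
Proof.
rewrite /realify -linearZ; congr mxvec; apply/matrixP => i j.
by rewrite !mxE coordsZ.
Qed.

Lemma realifyK m : cancel (@realify R F m) (@unrealify R F m).
Proof.
move=> v; apply/colP => i; rewrite mxE mxvecK -[RHS]coordsK; congr of_coords.
apply: (@eq_from_nth _ 0); first by rewrite size_map size_enum_ord size_coords.
move=> j; rewrite size_map size_enum_ord => jd.
rewrite (nth_map (Ordinal jd)) ?size_enum_ord// mxE.
by rewrite nth_enum_ord.
Qed.

Lemma unrealifyK m : cancel (@unrealify R F m) (@realify R F m).
Proof.
move=> u; rewrite -[RHS]vec_mxK; congr mxvec; apply/matrixP => i j.
rewrite !mxE of_coordsK; last by rewrite size_image card_ord.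
by rewrite (nth_map j) ?size_enum_ord// nth_ord_enum mxE.
Qed.

Lemma unrealify_linear m t (u v : 'rV[R]_(m * d)) :
  unrealify (t *: u + v) = of_real F t *: unrealify u + unrealify v :> 'cV[K]_m.
Proof.
apply: (can_inj (@realifyK m)).
by rewrite realifyD realifyZ !unrealifyK.
Qed.

Definition real_map m n (X : 'M[K]_(m, n)) (u : 'rV[R]_(n * d)) :
  'rV[R]_(m * d) := realify (X *m unrealify u).

Lemma real_map_linear m n (X : 'M[K]_(m, n)) : linear (real_map X).
Proof.
move=> t u v; rewrite /real_map unrealify_linear mulmxDr realifyD -realifyZ.
congr (realify _ + _); apply/colP => i; rewrite !mxE mulr_sumr.
by apply: eq_bigr => l _; rewrite mxE !mulrA of_real_comm.
Qed.

HB.instance Definition _ m n (X : 'M[K]_(m, n)) :=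
  GRing.isLinear.Build R _ _ _ (real_map X) (real_map_linear X).

(** Vectors are columns over K but rows over R, so real_mx is contravariant. *)
Definition real_mx m n (X : 'M[K]_(m, n)) : 'M[R]_(n * d, m * d) :=
  lin1_mx (real_map X).

Lemma detRE m (X : 'M[K]_m) : detR X = \det (real_mx X).
Proof. by []. Qed.

Lemma mul_real_mx m n (X : 'M[K]_(m, n)) u :
  u *m real_mx X = realify (X *m unrealify u).
Proof. by rewrite mul_rV_lin1. Qed.

Lemma realify_mul m n (X : 'M[K]_(m, n)) v :
  realify (X *m v) = realify v *m real_mx X.
Proof. by rewrite mul_real_mx realifyK. Qed.

Lemma eq_row_action m n (A B : 'M[R]_(m, n)) :
  (forall u : 'rV_m, u *m A = u *m B) -> A = B.
Proof. by move=> AB; apply/row_matrixP => i; rewrite !rowE. Qed.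

Lemma real_mx_mul m n p (X : 'M[K]_(m, n)) (Y : 'M[K]_(n, p)) :
  real_mx (X *m Y) = real_mx Y *m real_mx X.
Proof.
apply: eq_row_action => u.
by rewrite mulmxA !mul_real_mx realifyK mulmxA.
Qed.

Lemma real_mx0 m n : real_mx (0 : 'M[K]_(m, n)) = 0.
Proof.
by apply: eq_row_action => u; rewrite mul_real_mx mul0mx mulmx0 realify0.
Qed.

Lemma real_mx_scalar m t : real_mx (of_real F t)%:M = t%:M :> 'M[R]_(m * d).
Proof.
apply: eq_row_action => u.
by rewrite mul_real_mx mul_scalar_mx mul_mx_scalar realifyZ unrealifyK.
Qed.

Lemma realify_dot m (v w : 'cV[K]_m) :
  (realify v *m (realify w)^T) 0 0 = (coords ((adjmx v *m w) 0 0))`_0.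
Proof.
rewrite !mxE (reindex _ (curry_mxvec_bij _ _))/=.
rewrite (big_morph (fun z : K => (coords z)`_0)
  (fun x y => coordsD x y 0) (_ : (coords (0 : K))`_0 = 0)); last by case: F.
transitivity (\sum_i \sum_j realify v 0 (mxvec_index i j) *
    realify w 0 (mxvec_index i j)).
  by rewrite pair_bigA; apply: eq_bigr => -[i j] _; rewrite mxE.
apply: eq_bigr => i _; rewrite !mxE -coords_dot; apply: eq_bigr => j _.
by rewrite !mxvecE !mxE.
Qed.

(** Both sides are adjoint to X for the Euclidean inner product. *)
Lemma real_mx_adj m n (X : 'M[K]_(m, n)) : real_mx (adjmx X) = (real_mx X)^T.
Proof.
suff dot (u : 'rV_(m * d)) (w : 'rV_(n * d)) :
    u *m real_mx (adjmx X) *m w^T = u *m (real_mx X)^T *m w^T.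
  apply: eq_row_action => u; apply: trmx_inj; apply: eq_row_action => w.
  by apply: trmx_inj; rewrite !trmx_mul !trmxK dot.
apply/matrixP => a b; rewrite [a]ord1 [b]ord1 {a b}.
rewrite -[u]unrealifyK -[w]unrealifyK -realify_mul realify_dot.
rewrite adjmx_mul adjmxK -mulmxA -realify_dot realify_mul trmx_mul.
by rewrite mulmxA.
Qed.

Lemma real_mx_isometry m n (H : 'M[K]_(m, n)) :
  adjmx H *m H = 1%:M -> real_mx H *m (real_mx H)^T = 1%:M.
Proof.
move=> HH.
by rewrite -real_mx_adj -real_mx_mul HH -(of_real1 R F) real_mx_scalar.
Qed.

End RealMatrix.

(** * Volumes of projections and the cosine *)

Section Projections.
Variables (R : realType) (F : scalars) (m p : nat).
Local Notation K := (skewfield R F).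
Local Notation d := (rdim F).
Implicit Types (X H : 'M[K]_(m, p)) (T : set 'cV[K]_p) (S : set 'cV[K]_m).
Local Notation measure_of T := (lebesgue_outer (@realify R F p @` T)).

(** The factor by which X multiplies d p-dimensional volume. *)
Definition jacobian X : R :=
  Num.sqrt (\det (real_mx X *m (real_mx X)^T)).

Lemma VolR_image X T : row_free (real_mx X) ->
  VolR p (mulmx X @` T) = ((jacobian X)%:E * measure_of T)%E.
Proof.
move=> Xfree; rewrite -(@vol_mulmx _ (d * p) _ _ _ _ (mulnC _ _) Xfree).
congr vol; rewrite !image_comp; apply: eq_imagel => v _ /=.
by rewrite realify_mul.
Qed.

Lemma jacobian_isometry X : adjmx X *m X = 1%:M -> jacobian X = 1.
Proof. by move=> XX; rewrite /jacobian real_mx_isometry// det1 sqrtr1. Qed.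

Lemma row_free_compression X H : real_mx (adjmx H *m X) \in unitmx ->
  row_free (real_mx X).
Proof.
rewrite real_mx_mul => u; apply/row_freeP.
exists (real_mx (adjmx H) *m invmx (real_mx X *m real_mx (adjmx H))).
by rewrite mulmxA mulmxV.
Qed.

Lemma row_free_isometry X : adjmx X *m X = 1%:M -> row_free (real_mx X).
Proof. by move=> XX; apply/row_freeP; exists (real_mx X)^T; apply: real_mx_isometry. Qed.

Lemma range_preimage X S : S `<=` range (mulmx X) ->
  S = mulmx X @` [set u | S (X *m u)].
Proof.
move=> SX; apply/seteqP; split=> [v Sv|_ [u Su <-]//].
by have [u _ uv] := SX v Sv; exists u; rewrite //= uv.
Qed.

(** Testing orthogonality on the columns of H determines the coordinates of the
    projection in terms of H, hence its uniqueness. *)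
Lemma orthproj_range H v : adjmx H *m H = 1%:M ->
  orthproj (range (mulmx H)) v = H *m (adjmx H *m v).
Proof.
move=> HH; rewrite /orthproj; set P := [set w | _].
have PHv : P (H *m (adjmx H *m v)).
  split=> [|_ [u _ <-]]; first by exists (adjmx H *m v).
  by rewrite adjmx_mul -mulmxA mulmxBr [_ *m (H *m _)]mulmxA HH mul1mx subrr mulmx0.
have [[u0 _ <-] orth] := xgetPex 0 (ex_intro P _ PHv).
congr (H *m _); apply/row_matrixP => i; apply/eqP; rewrite eq_sym -subr_eq0.
have /orth : range (mulmx H) (H *m (delta_mx i 0 : 'cV[K]_p)) by exists (delta_mx i 0).
rewrite adjmx_mul -mulmxA mulmxBr [_ *m (H *m _)]mulmxA HH mul1mx mulmxBr !adj_delta_mul.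
by move/eqP.
Qed.

Lemma VolR_orthproj X H T : adjmx H *m H = 1%:M ->
    real_mx (adjmx H *m X) \in unitmx ->
  VolR p (orthproj (range (mulmx H)) @` (mulmx X @` T))
    = (`|detR (adjmx H *m X)|%:E * measure_of T)%E.
Proof.
move=> HH u.
have -> : orthproj (range (mulmx H)) @` (mulmx X @` T)
    = mulmx (H *m (adjmx H *m X)) @` T.
  rewrite image_comp; apply: eq_imagel => v _ /=.
  by rewrite orthproj_range// !mulmxA.
rewrite VolR_image; last first.
  by apply: (@row_free_compression _ H); rewrite mulmxA HH mul1mx.
congr (_%:E * _)%E; rewrite /jacobian real_mx_mul trmx_mul -mulmxA.
rewrite (mulmxA (real_mx H)) real_mx_isometry// mul1mx det_mulmx det_tr.
by rewrite -expr2 sqrtr_sqr.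
Qed.

(** Since X multiplies volume by 1, any admissible test set in the range of X is
    the image of a set of volume one in K^p, and all of them give the same
    value; S1 only witnesses that there is an admissible set. *)
Lemma absCos_range X H S1 : adjmx H *m H = 1%:M ->
    real_mx (adjmx H *m X) \in unitmx -> jacobian X = 1 ->
    unit_convex p (range (mulmx X)) S1 ->
  absCos p (range (mulmx X)) (range (mulmx H))
    = `|detR (adjmx H *m X)| `^ d%:R^-1.
Proof.
move=> HH u X1 S1unit; rewrite /absCos; set P := [set t | _].
have Pne : P ((fine (VolR p (orthproj (range (mulmx H)) @` S1))) `^ d%:R^-1).
  by exists S1.
have [S [[SX _ _ SV] ->]] := xgetPex 0 (ex_intro P _ Pne).
rewrite (range_preimage SX) VolR_orthproj//.
have := VolR_image [set u | S (X *m u)] (row_free_compression u).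
by rewrite -range_preimage// SV X1 mul1e => <-; rewrite mule1.
Qed.

End Projections.

Lemma convexK_mulmx (R : realType) (F : scalars) m n
    (X : 'M[skewfield R F]_(m, n)) (S : set 'cV[skewfield R F]_n) :
  convexK S -> convexK (mulmx X @` S).
Proof.
move=> Sconv x y l /set_mem[_ [v Sv <-] <-] /set_mem[_ [w Sw <-] <-].
have := Sconv (realify v) (realify w) l.
move=> /(_ (mem_set _) (mem_set _))/set_mem[]; [by exists v|by exists w|].
move=> z Sz zE; apply/mem_set; exists (X *m z); first by exists z.
rewrite !realify_mul zE; apply: etrans (mulmxDl _ _ _) _.
by rewrite -!scalemxAl.
Qed.


(** * The A-part of an element of the open cell *)

Section APart.
Variables (R : realType).

Lemma expmx_diag n (v : 'rV[R]_n) : expmx (diag_mx v) = diag_mx (map_mx expR v).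
Proof.
have powE k : diag_mx v ^+ k = diag_mx (\row_j v 0 j ^+ k).
  elim: k => [|k IH].
    by rewrite expr0; apply/matrixP => i j; rewrite !mxE expr0.
  rewrite exprS IH -[_ * _]/(_ *m _) mulmx_diag; congr diag_mx.
  by apply/rowP => j; rewrite !mxE exprS.
apply/matrixP => i j; rewrite !mxE.
have [<-|ij] := eqVneq i j; last first.
  rewrite mulr0n (_ : (fun N => _) = fun=> 0) ?lim_cst//.
  apply/funext => N; apply: big1 => k _.
  by rewrite powE !mxE (negbTE ij) mulr0n mulr0.
rewrite mulr1n (_ : (fun N => _) = series (exp_coeff (v 0 i)))//.
apply/funext => N.
rewrite seriesEnat /= big_mkord; apply: eq_bigr => k _.
by rewrite powE !mxE eqxx mulr1n mulrC.
Qed.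

Variable F : scalars.
Local Notation K := (skewfield R F).
Local Notation d := (rdim F).

Lemma map_of_real_scalar n (t : R) :
  map_mx (@of_real R F) t%:M = (of_real F t)%:M :> 'M[K]_n.
Proof.
apply/matrixP => i j; rewrite !mxE.
by case: eqP => _; rewrite ?mulr1n ?mulr0n ?of_real0.
Qed.

Lemma expHo_block p q (s : R) :
  expHo F p q s =
    block_mx (of_real F (expR (s * (q%:R / (p + q)%:R))))%:M 0
             0 (of_real F (expR (- (s * (p%:R / (p + q)%:R)))))%:M.
Proof.
rewrite /expHo (_ : s *: Ho R p q = diag_mx (row_mx
  (const_mx (s * (q%:R / (p + q)%:R)))
  (const_mx (- (s * (p%:R / (p + q)%:R)))))); last first.
  by rewrite diag_mx_row !diag_const_mx /Ho scale_block_mx !scaler0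
    !scale_scalar_mx mulrN.
rewrite expmx_diag map_row_mx !map_const_mx diag_mx_row !diag_const_mx.
rewrite map_block_mx !map_of_real_scalar.
by congr block_mx; apply/matrixP => i j; rewrite !mxE of_real0.
Qed.

Lemma ulsubmx_NbarP p q (x : 'M[K]_(p + q)) (s : R) :
    has_A_part x (expHo F p q s) ->
  exists2 a : 'M[K]_p, absdet a = 1 &
    ulsubmx x = a *m (of_real F (expR (s * (q%:R / (p + q)%:R))))%:M.
Proof.
case=> _ [_ [_ [_ [[Y _ <-] [_ [a [b [_ _ a1 _ ->]]]] [X _ <-] ->]]]].
exists a => //; rewrite expHo_block !mulmx_block block_mxKul.
by rewrite !(mul0mx, mulmx0, mul1mx, mulmx1, addr0, add0r).
Qed.

Lemma ln_absdet m (x : 'M[K]_m) : absdet x = 1 ->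
  detR x != 0 /\ ln `|detR x| = 0.
Proof.
move=> x1; have d0 : (d%:R : R)^-1 != 0 by rewrite invr_eq0 pnatr_eq0 -lt0n rdim_gt0.
have D0 : detR x != 0.
  apply/eqP => x0; move: x1; rewrite /absdet x0 normr0 powR0//.
  by move=> /eqP; rewrite eq_sym oner_eq0.
split=> //; apply: (mulfI d0); rewrite mulr0 -ln_powR.
by rewrite -/(absdet x) x1 ln1.
Qed.

Lemma ln_ulsubmx_NbarP p q (x : 'M[K]_(p + q)) (s : R) :
    has_A_part x (expHo F p q s) ->
  detR (ulsubmx x) != 0 /\
 ln `|detR (ulsubmx x)| = d%:R * (s * ((p * q)%:R / (p + q)%:R)).
Proof.
move=> /ulsubmx_NbarP[a /ln_absdet[a0 lna] ->].
set e := expR _; have e0 : 0 < e by exact: expR_gt0.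
have -> : detR (a *m (of_real F e)%:M) = e ^+ (p * d) * detR a.
  by rewrite !detRE real_mx_mul det_mulmx real_mx_scalar det_scalar.
split; first by rewrite mulf_neq0 ?expf_neq0// lt0r_neq0.
rewrite normrM gtr0_norm ?exprn_gt0//.
rewrite lnM ?posrE ?exprn_gt0 ?normr_gt0// lna addr0 lnXn// expRK.
by rewrite -mulr_natr !natrM; ring.
Qed.

(** The formula holds for every A-part of x and every logarithm s of it, so it
    holds for the chosen ones. *)
Lemma Apow_alphaP p q (x : 'M[K]_(p + q)) (l : R[i]) : NbarP x ->
  detR (ulsubmx x) != 0 /\
 Apow (alphaP x) l = cpow `|detR (ulsubmx x)| (l / d%:R).
Proof.
move=> xN; have aP : has_A_part x (alphaP x) := xgetPex 0 xN.
have [s _ sa] := aP.1.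
have := @xgetPex _ 0 [set s | alphaP x = expHo F p q s] (ex_intro _ s (esym sa)).
rewrite /Apow; move: (xget _ _) => t /= ta; move: aP; rewrite ta.
move=> /ln_ulsubmx_NbarP[D0 lnD]; split=> //.
rewrite /cpow lnD; congr cexp.
have d0 : d%:R != 0 :> R[i] by rewrite pnatr_eq0 -lt0n rdim_gt0.
(* The quotient by p + q is kept as an atom: p + q may be 0 here. *)
rewrite !rmorphM fmorphV !rmorph_nat/=.
by move: (_ / (p + q)%:R) => c; field.
Qed.

Lemma cpow_powR (D : R) (l : R[i]) : cpow (D `^ d%:R^-1) l = cpow D (l / d%:R).
Proof.
rewrite /cpow ln_powR; congr cexp.
by rewrite rmorphM fmorphV rmorph_nat mulrA.
Qed.

End APart.


(** * The base point and the unitary group *)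

Section Corner.
Variables (R : realType) (F : scalars) (p q : nat).
Local Notation K := (skewfield R F).

Definition bo_incl : 'M[K]_(p + q, p) := col_mx 1%:M 0.

Lemma boE : bo R F p q = range (mulmx bo_incl).
Proof.
by apply: eq_imagel => u _; rewrite /bo_incl mul_col_mx mul1mx mul0mx.
Qed.

Lemma gract_bo (x : 'M[K]_(p + q)) :
  gract x (bo R F p q) = range (mulmx (x *m bo_incl)).
Proof.
by rewrite boE /gract image_comp; apply: eq_imagel => u _ /=; rewrite mulmxA.
Qed.

Lemma adjmx_bo_incl : adjmx bo_incl = row_mx 1%:M 0.
Proof.
by rewrite /adjmx /bo_incl map_col_mx tr_col_mx -!/(adjmx _) adjmx1 adjmx0.
Qed.

Lemma bo_incl_isometry : adjmx bo_incl *m bo_incl = 1%:M.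
Proof.
by rewrite adjmx_bo_incl /bo_incl mul_row_col mul1mx mul0mx addr0.
Qed.

Lemma compress_bo (x : 'M[K]_(p + q)) :
  adjmx bo_incl *m (x *m bo_incl) = ulsubmx x.
Proof.
rewrite adjmx_bo_incl -[x in LHS]submxK /bo_incl mul_block_col !mulmx1 !mulmx0.
by rewrite !addr0 mul_row_col mul1mx mul0mx addr0.
Qed.

End Corner.

(** The convention minv k = 0 for a singular k would force k^* = 0, hence k = 0,
    which has determinant 0 and is not in SL. *)
Lemma Kgrp_isometry (R : realType) (F : scalars) m
    (k : 'M[skewfield R F]_m) : (0 < m)%N -> Kgrp k -> adjmx k *m k = 1%:M.
Proof.
move=> m0 [kSL kadj].
have [kinv|] := pselect (exists y, is_inv k y).
  by have [_] := xgetPex 0 (kinv : exists y, [set y | is_inv k y] y); rewrite kadj.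
move=> knot; have k0 : k = 0.
  rewrite -[k]adjmxK kadj /minv xgetPN ?adjmx0// => y yk.
  by apply: knot; exists y.
exfalso; move: kSL; rewrite {}k0 {kadj knot k}.
case: m m0 => // m _; case: F => /=.
- by rewrite det0 => /eqP; rewrite eq_sym oner_eq0.
- by rewrite det0 => /eqP; rewrite eq_sym oner_eq0.
- rewrite /absdet detRE real_mx0 det0 normr0 powR0 ?invr_eq0 ?pnatr_eq0//.
  by move=> /eqP; rewrite eq_sym oner_eq0.
Qed.

Theorem theorem4p2 (R : realType) (F : scalars) (p q : nat)
    (hp : (1 <= p)%N) (hq : (1 <= q)%N) (hpq : (p <= q)%N)
    (E : set 'cV[skewfield R F]_(p + q)) (hE : unit_convex p (bo R F p q) E) :
  (forall (x : 'M[skewfield R F]_(p + q)) (l : R[i]),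
     SLmx x -> NbarP x ->
     Apow (alphaP x) l
       = cpow `|fine (VolR p (orthproj (bo R F p q) @` (mulmx x @` E)))|
              (l / (rdim F)%:R)
     /\ (VolR p (mulmx x @` E) = 1%E ->
         cpow `|fine (VolR p (orthproj (bo R F p q) @` (mulmx x @` E)))|
              (l / (rdim F)%:R)
         = cpow (absCos p (gract x (bo R F p q)) (bo R F p q)) l))
  /\
  (forall (b c : set 'cV[skewfield R F]_(p + q))
      (k h : 'M[skewfield R F]_(p + q)) (l : R[i]),
     Gr p b -> Gr p c -> Kgrp k -> Kgrp h ->
     b = gract k (bo R F p q) -> c = gract h (bo R F p q) ->
     NbarP (minv h *m k) ->
     Apow (alphaP (minv h *m k)) l = cpow (absCos p b c) l).
Proof.
case: hE => E_bo E_convex E_0 E_vol.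
pose I := bo_incl R F p q; pose D := [set u | E (I *m u)].
have EI : E = mulmx I @` D by apply: range_preimage; rewrite -boE.
have D_vol : lebesgue_outer (@realify R F p @` D) = 1%E.
  have := VolR_image D (row_free_isometry (bo_incl_isometry R F p q)).
  by rewrite -EI E_vol (jacobian_isometry (bo_incl_isometry R F p q)) mul1e.
have xE (x : 'M[skewfield R F]_(p + q)) : mulmx x @` E = mulmx (x *m I) @` D.
  rewrite EI image_comp; apply: eq_imagel => u _ /=; exact: mulmxA.
have unit_of (x : 'M[skewfield R F]_(p + q)) :
    NbarP x -> real_mx (ulsubmx x) \in unitmx.
  by move=> /(Apow_alphaP 0)[]; rewrite detRE unitmxE unitfE.
split=> [x l _ xN|b c k h l _ _ kK hK -> -> hkN].
  have [_ ->] := Apow_alphaP l xN.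
  have xu : real_mx (adjmx I *m (x *m I)) \in unitmx.
    by rewrite compress_bo; exact: unit_of.
  rewrite xE gract_bo boE VolR_orthproj ?bo_incl_isometry// compress_bo D_vol mule1 /=.
  rewrite normr_id; split=> // x_vol.
  have x_jac : jacobian (x *m I) = 1.
    have := VolR_image D (row_free_compression xu).
    by rewrite x_vol D_vol mule1 => -[].
  rewrite -cpow_powR -compress_bo.
  rewrite -(absCos_range (bo_incl_isometry R F p q) xu x_jac
    (S1 := mulmx x @` E))//.
  split=> //.
  - by rewrite xE => _ [u _ <-]; exists u.
  - exact: convexK_mulmx.
  - by exists 0 => //; rewrite mulmx0.
  - by rewrite xE.
have pq0 : (0 < p + q)%N by rewrite addn_gt0 hp.
have kk := Kgrp_isometry pq0 kK; have hh := Kgrp_isometry pq0 hK.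
have isoI (g : 'M[skewfield R F]_(p + q)) :
    adjmx g *m g = 1%:M -> adjmx (g *m I) *m (g *m I) = 1%:M.
  by move=> gg; rewrite adjmx_mul -mulmxA (mulmxA _ g) gg mul1mx bo_incl_isometry.
have [_ ->] := Apow_alphaP l hkN.
have compr : adjmx (h *m I) *m (k *m I) = ulsubmx (minv h *m k).
  by rewrite -compress_bo adjmx_mul -!mulmxA -hK.2.
rewrite -cpow_powR !gract_bo -compr; rewrite (absCos_range _ _ _ (S1 := mulmx k @` E))//.
- exact: isoI.
- by rewrite compr; exact: unit_of.
- by apply: jacobian_isometry; exact: isoI.
split=> //.
- by rewrite xE => _ [u _ <-]; exists u.
- exact: convexK_mulmx.
- by exists 0 => //; rewrite mulmx0.
- rewrite xE VolR_image; last by apply: row_free_isometry; exact: isoI.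
  by rewrite D_vol mule1 jacobian_isometry//; exact: isoI.
Qed.
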